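(* Let $\mathcal A=\{r_0,\dots,r_m\}\subset\mathbb Z^n$ with $\mathbb Z\mathcal A=\mathbb Z^n$ and $k\ge1$. The tropicalization $\operatorname{trop}(Y_{\mathcal A}^{(k)})\subset\mathbb R^{m+1}$ is equal to the Minkowski sum \[\operatorname{trop}(Y_{\mathcal A}^{(k)})=\operatorname{Rowspan}(A)+\operatorname{trop}(\operatorname{Ker}(A^{(k)})).\] Its image $\pi(\operatorname{trop}(Y^{(k)}_{\mathcal A}))$ in $\mathbb R^{m+1}/\!\sim$ is the tropicalization of the $k$-th dual variety $X_{\mathcal A}^{(k)}$.
   Context: $X_{\mathcal A}\subset\mathbb P^m$ is the closure of the image of $(\mathbb C^* )^n\to\mathbb P^m$, $x\mapsto(x^{r_0}:\dots:x^{r_m})$. $X^{(k)}_{\mathcal A}\subset(\mathbb P^m)^\vee$ is its $k$-th dual variety: the closure of the set of hyperplanes containing the $k$-th osculating space $\mathbb P(\operatorname{Im}j_{k,x})$ at some smooth point $x$ (where $j_{k,x}$ is Taylor expansion of linear forms to order $k$); $Y^{(k)}_{\mathcal A}\subset\mathbb C^{m+1}$ is its affine cone. $A$ is the $(n+1)\times(m+1)$ integer matrix with columns $(1,r_i)$ and $\operatorname{Rowspan}(A)$ is its real row span. $A^{(k)}$ is the $\binom{n+k}{k}\times(m+1)$ matrix whose rows, indexed by $\beta\in\mathbb N^n$ with $|\beta|\le k$, are $(r_0^\beta,\dots,r_m^\beta)$; $\operatorname{Ker}(A^{(k)})\subset\mathbb C^{m+1}$ is its kernel, a linear subvariety. For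 a variety $Y\subset\mathbb C^{m+1}$ with ideal $I$ defined over $\mathbb Q$ (trivial valuation), $\operatorname{trop}(Y)=\{w\in\mathbb R^{m+1}:\operatorname{in}_w(F)\text{ is not a monomial for every }0\ne F\in I\}$, where $\operatorname{in}_w(F)$ is the sum of the terms $F_\alpha x^\alpha$ of $F$ minimizing $\langle\alpha,w\rangle$. $\mathbb R^{m+1}/\!\sim$ is the quotient by the line $\mathbb R(1,\dots,1)$, $\pi$ the projection, and for a projective variety $X$ with affine cone $Y$, $\operatorname{trop}(X)=\pi(\operatorname{trop}(Y))$.
   Formalization: The k-th dual variety is taken as the closure over points of the torus orbit only, not all smooth points (with all smooth points the equality can fail for k ≥ 2); the last sentence on π(trop(Y)) is left out, being the definition of trop of a projective variety. *)

(* Defs.v *)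
From HB Require Import structures.
From mathcomp Require Import all_boot all_order all_algebra.
From mathcomp Require Import reals Rstruct.
From mathcomp Require Import complex.
From mathcomp Require Import mpoly.

Set Implicit Arguments.
Unset Strict Implicit.
Unset Printing Implicit Defensive.
Import GRing.Theory Num.Theory.
Local Open Scope ring_scope.

Definition RR : rcfType := Rdefinitions.R.
Definition CC : closedFieldType := complex RR.

Definition lattice_generates (n m : nat) (r : 'I_m.+1 -> 'I_n -> int) : Prop :=
  forall v : 'I_n -> int, exists c : 'I_m.+1 -> int,
    forall j : 'I_n, v j = \sum_(i < m.+1) c i * r i j.

Definition ffact_int (z : int) (b : nat) : int :=
  \prod_(0 <= l < b) (z - l%:Z).

(* The partial derivative  d^beta (t^r)  of the Laurent monomial t^r = prod_j t_j^{r_j},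
   evaluated at a torus point x. *)
Definition dlaurent (n : nat) (r : 'I_n -> int) (beta : 'I_n -> nat) (x : 'I_n -> CC) : CC :=
  \prod_(j < n) ((ffact_int (r j) (beta j))%:~R * x j ^ (r j - (beta j)%:Z)).

Definition deg_le (n : nat) (beta : 'I_n -> nat) (k : nat) : bool :=
  (\sum_(j < n) beta j <= k)%N.

(* Affine cone Y^(k)_A (before closure): vectors y in C^{m+1} such that the hyperplane
   sum_i y_i z_i contains the k-th osculating space of X_A at a torus point x, i.e. the
   Taylor expansion j_{k,x} of the linear form  t |-> sum_i y_i t^{r_i}  vanishes:
   all partial derivatives of order <= k vanish at x. *)
Definition kdual_cone (n m k : nat) (r : 'I_m.+1 -> 'I_n -> int) (y : 'I_m.+1 -> CC) : Prop :=
  exists x : 'I_n -> CC, (forall j, x j != 0) /\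
    forall beta : 'I_n -> nat, deg_le beta k ->
      \sum_(i < m.+1) y i * dlaurent (r i) beta x = 0.

Definition kerAk (n m k : nat) (r : 'I_m.+1 -> 'I_n -> int) (y : 'I_m.+1 -> CC) : Prop :=
  forall beta : 'I_n -> nat, deg_le beta k ->
    \sum_(i < m.+1) (\prod_(j < n) r i j ^+ beta j)%:~R * y i = 0.

Definition Amx (n m : nat) (r : 'I_m.+1 -> 'I_n -> int) : 'M[RR]_(n.+1, m.+1) :=
  \matrix_(a < n.+1, i < m.+1)
     match unlift ord0 a with None => 1 | Some j => (r i j)%:~R end.

Definition mweight (m : nat) (w : 'rV[RR]_m.+1) (alpha : 'X_{1..m.+1}) : RR :=
  \sum_(i < m.+1) (alpha i)%:R * w ord0 i.

Definition init_form (m : nat) (w : 'rV[RR]_m.+1) (F : {mpoly CC[m.+1]}) : {mpoly CC[m.+1]} :=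
  \sum_(alpha <- msupp F |
        all (fun b => mweight w alpha <= mweight w b) (msupp F))
     F@_alpha *: 'X_[alpha].

Definition is_monomial (m : nat) (G : {mpoly CC[m.+1]}) : Prop :=
  exists (c : CC) (alpha : 'X_{1..m.+1}), c != 0 /\ G = c *: 'X_[alpha].

(* Tropicalization (trivial valuation) of the Zariski closure of S in C^{m+1}:
   its ideal is the ideal of all polynomials vanishing on S. *)
Definition trop (m : nat) (S : ('I_m.+1 -> CC) -> Prop) (w : 'rV[RR]_m.+1) : Prop :=
  forall F : {mpoly CC[m.+1]}, F != 0 -> (forall y, S y -> F.@[y] = 0) ->
    ~ is_monomial (init_form w F).

(* Main.v *)
(** The cone is the image of Torus x Ker under (x, z) |-> (z_i x^{-r_i}), so a polynomial
    vanishes on it iff each of its A-homogeneous parts vanishes on Ker. Since a vector of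
    Rowspan(A) shifts all weights in such a part by the same amount, this gives one inclusion.

    Conversely, let w be in the tropicalization of the cone. Then 1 is not in the ring of
    A-degree-zero Laurent polynomials of positive w-weight, taken as functions on the torus
    part of Ker, and Zorn's lemma (as in Chevalley's extension theorem) produces a valuation
    for which these functions are positive. It preorders the coordinates z_i so that every
    linear form vanishing on Ker attains its minimum twice. By Farkas' lemma, an element of
    Rowspan(A) moves w to real weights compatible with this preorder, and the vanishing
    linear forms are a tropical basis of a linear space. *)
Require Import Defs.
From HB Require Import structures.
From mathcomp Require Import all_boot all_order all_algebra.
From mathcomp Require Import boolp classical_sets functions.
From mathcomp Require Import reals Rstruct.
From mathcomp Require Import complex.
From mathcomp Require Import mpoly.
From mathcomp Require Import lra zify.
Import Order.TTheory GRing.Theory Num.Theory.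
Local Open Scope ring_scope.

Set Implicit Arguments.
Unset Strict Implicit.
Unset Printing Implicit Defensive.

(** * Valuations from maximal nonunital subrings *)

Section ValuationPair.
Variables (R : comPzRingType) (D M0 : R -> Prop).
Hypothesis DN1 : D (-1).

Definition nonunital_subring (M : R -> Prop) : Prop :=
  [/\ forall a b, M a -> M b -> M (a + b),
      forall a b, M a -> M b -> M (a * b) &
      forall d a, D d -> M a -> M (d * a)].

Definition avoids_one (M : R -> Prop) : Prop :=
  [/\ nonunital_subring M, forall a, M0 a -> M a & ~ M 1].

(** For the maximal [M] obtained below, this acts on the units of [R] as a valuation ring, with [M]
    as its elements of positive value. *)
Definition idealizer (M : R -> Prop) (x : R) : Prop := forall a, M a -> M (x * a).

(** Horner form of the polynomials in [x] of degree at most [p] with all coefficients, including the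
    constant one, in [M]. *)
Fixpoint adjoin (M : R -> Prop) (x : R) (p : nat) (f : R) : Prop :=
  if p is p'.+1 then exists a g, [/\ M a, adjoin M x p' g & f = a + x * g] else M f.

Section Adjoin.
Variable M : R -> Prop.
Hypothesis subM : nonunital_subring M.
Hypothesis M_0 : M 0.

Let addM := let: And3 h _ _ := subM in h.
Let mulM := let: And3 _ h _ := subM in h.
Let dM := let: And3 _ _ h := subM in h.

Lemma adjoinS x p f : adjoin M x p f -> adjoin M x p.+1 f.
Proof.
elim: p f => [|p IH] f /=.
  by move=> Mf; exists f, 0; split; rewrite // mulr0 addr0.
move=> [a [g [Ma Mg ->]]]; exists a, g; split=> //.
exact: IH.
Qed.

Lemma adjoin_le x p q f : (p <= q)%N -> adjoin M x p f -> adjoin M x q f.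
Proof.
move=> /subnKC <-; elim: (q - p)%N => [|d IH]; first by rewrite addn0.
by rewrite addnS => /IH /adjoinS.
Qed.

Lemma adjoin_mem x p f : M f -> adjoin M x p f.
Proof. exact: (@adjoin_le x 0). Qed.

Lemma adjoin_add x p f g : adjoin M x p f -> adjoin M x p g -> adjoin M x p (f + g).
Proof.
elim: p f g => [|p IH] f g /=; first exact: addM.
move=> [a [f' [Ma Mf ->]]] [b [g' [Mb Mg ->]]].
exists (a + b), (f' + g'); split; [exact: addM | exact: IH |].
by rewrite mulrDr addrACA.
Qed.

Lemma adjoin_scale x p (c f : R) :
  idealizer M c -> adjoin M x p f -> adjoin M x p (c * f).
Proof.
move=> Vc; elim: p f => [|p IH] f /=; first exact: Vc.
move=> [a [g [Ma Mg ->]]]; exists (c * a), (c * g); split; [exact: Vc|exact: IH|].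
by rewrite mulrDr mulrCA.
Qed.

Lemma adjoin_shift x p f : adjoin M x p f -> adjoin M x p.+1 (x * f).
Proof. by move=> Mf; exists 0, f; split; rewrite // add0r. Qed.

Lemma adjoin_mul x p q f g :
  adjoin M x p f -> adjoin M x q g -> adjoin M x (p + q) (f * g).
Proof.
elim: p f g => [|p IH] f g; first by move=> Mf; apply: adjoin_scale => a; apply: mulM.
move=> [a [f' [Ma Mf ->]]] Mg; rewrite mulrDl -mulrA.
apply: adjoin_add; last by apply: adjoin_shift; apply: IH.
apply: (@adjoin_le x q); first by rewrite leq_addl.
by apply: adjoin_scale => // b; apply: mulM.
Qed.

Lemma adjoin_top x p f : adjoin M x p.+1 f ->
  exists g a, [/\ adjoin M x p g, M a & f = g + a * x ^+ p.+1].
Proof.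
elim: p f => [|p IH] f [a [g [Ma Mg ->]]].
  by exists a, g; split=> //; rewrite expr1 mulrC.
have [g' [b [Mg' Mb ->]]] := IH _ Mg.
exists (a + x * g'), b; split=> //; first by exists a, g'.
by rewrite mulrDr addrA mulrCA -exprS.
Qed.

(** The factor [x ^+ p] turns each power [y ^+ i] with [i <= p] into [x ^+ (p - i)]. *)
Lemma adjoin_inv_shift x y p q f : x * y = 1 -> (q <= p)%N ->
  adjoin M y q f -> adjoin M x p (x ^+ p * f).
Proof.
move=> xy; elim: q p f => [|q IH] p f /=.
  move=> _; elim: p => [|p IHp] Mf; first by rewrite mul1r.
  by rewrite exprS -mulrA; apply: adjoin_shift; apply: IHp.
case: p => // p qp [a [g [Ma Mg ->]]]; rewrite mulrDr; apply: adjoin_add.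
  rewrite exprS -mulrA; apply: adjoin_shift.
  elim: (p) => [|k IHk]; first by rewrite mul1r.
  by rewrite exprS -mulrA; apply: adjoin_shift.
rewrite exprS (mulrC x) -mulrA (mulrA x) xy mul1r.
by apply: adjoinS; apply: IH.
Qed.

Let oppM a : M a -> M (- a).
Proof. by move=> Ma; rewrite -mulN1r; apply: dM. Qed.

(** Write [1 = g + a * x ^+ p.+1] with [g] of degree at most [p], and [1 - b = y * h]. Multiplying
    the first equation by [1 - b] replaces its top term by [a * x ^+ p * h], where [h] has degree at
    most [p] in [y]; adding [b] restores 1 on the left, now with degree at most [p] in [x]. *)
Lemma adjoin_reduce x y p q : x * y = 1 -> ~ M 1 -> (q <= p.+1)%N ->
  adjoin M x p.+1 1 -> adjoin M y q 1 -> adjoin M x p 1.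
Proof.
move=> xy M1 + /adjoin_top [g [a [Mg Ma E1]]].
case: q => [//|q] qp /= [b [h [Mb Mh E2]]].
have -> : 1 = b + (g + (- b) * g) + a * (x ^+ p * h).
  have E3 : a * x ^+ p.+1 * (1 - b) = a * (x ^+ p * h).
    have -> : 1 - b = y * h by rewrite E2 addrC addKr.
    by rewrite exprS -mulrA mulrACA xy mul1r.
  rewrite -E3; set T := a * x ^+ p.+1; rewrite -/T in E1.
  transitivity (b + (g + T) - b * (g + T)); first by rewrite -E1 mulr1 addrAC subrr add0r.
  rewrite mulrDr opprD mulNr mulrBr mulr1 [T * b]mulrC -!addrA.
  by congr (_ + (_ + _)); rewrite addrCA.
apply: adjoin_add; last first.
  apply: adjoin_scale; first by move=> c; apply: mulM.
  exact: (adjoin_inv_shift (q := q) xy).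
apply: adjoin_add; first exact: adjoin_mem.
apply: adjoin_add => //; apply: adjoin_scale => // c; apply: mulM; exact: oppM.
Qed.

(* Chevalley's extension lemma, by descent on the degrees [p] and [q]. *)
Lemma adjoin_one_or_inv x y p q : x * y = 1 -> ~ M 1 ->
  adjoin M x p 1 -> adjoin M y q 1 -> False.
Proof.
move=> + M1; move: {2}(p + q)%N (leqnn (p + q)%N) => s.
elim: s x y p q => [|s IH] x y p q.
  by rewrite leqn0 addn_eq0 => /andP[/eqP -> _].
wlog qp : x y p q / (q <= p)%N.
  move=> H; have /orP[|pq] := leq_total q p; first exact: H.
  by rewrite addnC => le xy Mx My; apply: (H y x q p pq le) => //; rewrite mulrC.
case: p qp => [|p] qp le xy Mx My //.
have Mx' := adjoin_reduce xy M1 qp Mx My.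
by apply: (IH x y p q).
Qed.

End Adjoin.

Lemma maximal_avoids_one : M0 0 -> nonunital_subring M0 -> ~ M0 1 ->
  exists M, avoids_one M /\
    forall M', avoids_one M' -> (forall a, M a -> M' a) -> forall a, M' a -> M a.
Proof.
move=> M00 sub0 M01.
have avoid0 : avoids_one M0 by [].
(* Each set is joined with [M0] so that the union of the empty chain is admissible too. *)
pose P (X : set R) := avoids_one (fun a => X a \/ M0 a).
have [|A [PA maxA]] := @Zorn_bigcup R P.
  move=> F FP totF.
  (* Two elements of the union already lie in a common admissible [N] below it, where sums and
     products can be formed. *)
  have pair a b : ((\bigcup_(X in F) X)%classic a \/ M0 a) ->
      ((\bigcup_(X in F) X)%classic b \/ M0 b) ->
      exists N : R -> Prop, [/\ avoids_one N, N a, N b &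
        forall c, N c -> (\bigcup_(X in F) X)%classic c \/ M0 c].
    have use (X : set R) : F X -> forall c, X c \/ M0 c -> (\bigcup_(X in F) X)%classic c \/ M0 c.
      by move=> FX c [Xc|]; [left; exists X | right].
    move=> [[X FX Xa]|Ma] [[Y FY Yb]|Mb].
    - have [XY|YX] := totF _ _ FX FY.
        exists (fun a => Y a \/ M0 a); split; [exact: FP|by left; apply: XY|by left|exact: use].
      exists (fun a => X a \/ M0 a); split; [exact: FP|by left|by left; apply: YX|exact: use].
    - exists (fun a => X a \/ M0 a); split; [exact: FP|by left|by right|exact: use].
    - exists (fun a => Y a \/ M0 a); split; [exact: FP|by right|by left|exact: use].
    - by exists M0; split=> // c; right.
  split; first split.
  - move=> a b Ha Hb; have [N [[[aN _ _] _ _] Na Nb useN]] := pair _ _ Ha Hb.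
    exact/useN/aN.
  - move=> a b Ha Hb; have [N [[[_ mN _] _ _] Na Nb useN]] := pair _ _ Ha Hb.
    exact/useN/mN.
  - move=> d a Dd Ha; have [N [[[_ _ dN] _ _] Na _ useN]] := pair _ _ Ha Ha.
    exact/useN/dN.
  - by move=> a Ma; right.
  - by move=> H1; have [N [[_ _ N1] Na _ _]] := pair _ _ H1 H1.
exists (fun a => A a \/ M0 a); split=> // M' avM' sAM' a M'a.
apply: contrapT => nAa; apply: (maxA M').
  split; first by move=> b Ab; apply: sAM'; left.
  by move=> sM'A; apply: nAa; left; apply: sM'A.
case: avM' => sub' s0 n1.
have E : (fun a => M' a \/ M0 a) = M'.
  by apply/funext => b; apply/propext; split=> [[//|/s0]|]; last by left.
by rewrite /P E.
Qed.

Section Maximal.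
Variable M : R -> Prop.
Hypothesis M00 : M0 0.
Hypothesis avM : avoids_one M.
Hypothesis maxM :
  forall M', avoids_one M' -> (forall a, M a -> M' a) -> forall a, M' a -> M a.

Let subM : nonunital_subring M := let: And3 h _ _ := avM in h.
Let M1 : ~ M 1 := let: And3 _ _ h := avM in h.
Let addM := let: And3 h _ _ := subM in h.
Let mulM := let: And3 _ h _ := subM in h.
Let dM := let: And3 _ _ h := subM in h.
Let sM0 : forall a, M0 a -> M a := let: And3 _ h _ := avM in h.
Let M_0 : M 0 := sM0 M00.

Lemma idealizer_mul x y : idealizer M x -> idealizer M y -> idealizer M (x * y).
Proof. by move=> Vx Vy a Ma; rewrite -mulrA; apply/Vx/Vy. Qed.

Lemma idealizer1 : idealizer M 1.
Proof. by move=> a; rewrite mul1r. Qed.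

(** The polynomials in [x] over [M] form a nonunital subring containing [M]. If 1 is not among them,
    maximality puts them all, in particular [x * a], into [M]. *)
Lemma not_adjoin_one_idealizer x : (forall p, ~ adjoin M x p 1) -> idealizer M x.
Proof.
move=> n1 a Ma; apply: (@maxM (fun f => exists p, adjoin M x p f)).
- split; first split.
  + move=> f g [p Mf] [q Mg]; exists (maxn p q).
    apply: adjoin_add => //; first exact: (adjoin_le M_0 (leq_maxl _ _) Mf).
    exact: (adjoin_le M_0 (leq_maxr _ _) Mg).
  + by move=> f g [p Mf] [q Mg]; exists (p + q)%N; apply: adjoin_mul.
  + by move=> d f Dd [p Mf]; exists p; apply: adjoin_scale => // b; apply: dM.
  + by move=> b /sM0 Mb; exists 0.
  + by move=> [p]; apply: n1.
- by move=> b Mb; exists 0.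
- by exists 1; apply: adjoin_shift.
Qed.

Lemma idealizer_or_inv x y : x * y = 1 -> idealizer M x \/ idealizer M y.
Proof.
move=> xy; have [|nVx] := pselect (idealizer M x); [by left | right].
apply: not_adjoin_one_idealizer => q My.
apply: nVx; apply: not_adjoin_one_idealizer => p Mx.
exact: (adjoin_one_or_inv subM M_0 xy M1 Mx My).
Qed.

(** With [V] the idealizer, [M + x V] is a nonunital subring containing [M] and [x], so by
    maximality it suffices that it avoids 1. *)
Lemma noninvertible_mem x y : x * y = 1 -> idealizer M x -> ~ idealizer M y -> M x.
Proof.
move=> xy Vx nVy.
have oppM a : M a -> M (- a) by move=> Ma; rewrite -mulN1r; apply: dM.
apply: (@maxM (fun f => exists a b, [/\ M a, idealizer M b & f = a + x * b])).
- split; first split.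
  + move=> _ _ [a [b [Ma Vb ->]]] [a' [b' [Ma' Vb' ->]]].
    exists (a + a'), (b + b'); split; [exact: addM| |by rewrite mulrDr addrACA].
    by move=> c Mc; rewrite mulrDl; apply: addM; [exact: Vb|exact: Vb'].
  + move=> _ _ [a [b [Ma Vb ->]]] [a' [b' [Ma' Vb' ->]]].
    exists (a * a' + (x * (b * a') + x * (b' * a))), (b * (x * b')); split.
    * apply: addM; [exact: mulM|]; apply: addM; apply: Vx; [exact: Vb|exact: Vb'].
    * by do !apply: idealizer_mul.
    * rewrite mulrDl !mulrDr addrACA -!addrA; congr (_ + _).
      by rewrite [a * (x * b')]mulrC -!mulrA addrCA.
  + move=> d _ Dd [a [b [Ma Vb ->]]]; exists (d * a), (d * b); split; first exact: dM.
      by apply: idealizer_mul => // c; apply: dM.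
    by rewrite mulrDr mulrCA.
  + move=> a /sM0 Ma; exists a, 0; split=> //; last by rewrite mulr0 addr0.
    by move=> b; rewrite mul0r.
  (* As [y] is not in [V], 1 is a polynomial in [y] over [M], and multiplying it by [x ^+ q] gives
     [x ^+ q] in [M]. Hence [(x * b) ^+ q] is in [M]; but it equals [(1 - a) ^+ q], which is 1 minus
     an element of [M]. *)
  + move=> [a [b [Ma Vb E1]]]; apply: nVy; apply: not_adjoin_one_idealizer => q My.
    have Mxq : M (x ^+ q).
      have : forall p f, adjoin M y p f -> M (x ^+ p * f).
        elim=> [|p IH] f /=; first by rewrite mul1r.
        move=> [c [g [Mc /IH Mg ->]]]; rewrite mulrDr; apply: addM.
          elim: (p.+1) => [|k IHk]; first by rewrite mul1r.
          by rewrite exprS -mulrA; apply: Vx.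
        by rewrite exprS mulrACA xy mul1r.
      by move=> /(_ _ _ My); rewrite mulr1.
    have Mbq : M ((x * b) ^+ q).
      rewrite exprMn mulrC; elim: {1}q => [|k IHk]; first by rewrite mul1r.
      by rewrite exprS -mulrA; apply: Vb.
    have xb : x * b = 1 - a by rewrite E1 addrC addKr.
    apply: M1; move: Mbq; rewrite xb.
    have : forall k, exists2 c, M c & (1 - a) ^+ k = 1 - c.
      elim=> [|k [c Mc IHk]]; first by exists 0; rewrite ?subr0.
      exists (a + c - a * c); last first.
        rewrite exprS IHk mulrBl mul1r mulrBr mulr1 !opprB opprD -addrA.
        by congr (_ + _); rewrite addrC -addrA.
      by apply: addM; [exact: addM | apply/oppM/mulM].
    by move=> /(_ q) [c Mc ->] M1c; rewrite -[1](subrK c); apply: addM.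
- by move=> a Ma; exists a, 0; split=> //; [move=> b; rewrite mul0r | rewrite mulr0 addr0].
- by exists 0, 1; split=> //; [exact: idealizer1 | rewrite mulr1 add0r].
Qed.

End Maximal.
End ValuationPair.

(** * Farkas' lemma *)

(* Fourier-Motzkin elimination; closure of [Q] under addition makes it contain
   every inequality derived by nonnegative integer combinations. *)
Lemma fourier_motzkin (F : realFieldType) (n : nat) (Q : (nat -> int) -> F -> Prop)
    (s : seq ((nat -> int) * F)) :
  (forall a b g h, Q a g -> Q b h -> Q (fun j => a j + b j) (g + h)) ->
  (forall a h, (forall j, a j = 0) -> Q a h -> 0 <= h) ->
  (forall p j, List.In p s -> (n <= j)%N -> p.1 j = 0) ->
  (forall p, List.In p s -> Q p.1 p.2) ->
  exists c : nat -> F, forall p, List.In p s -> \sum_(j < n) (p.1 j)%:~R * c j <= p.2.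
Proof.
move=> Qadd Q0.
have Qmul a h k : Q a h -> Q (fun j => a j *+ k.+1) (h *+ k.+1).
  move=> Qah; elim: k => [|k IH]; first by rewrite mulr1n.
  rewrite mulrS; have -> : (fun j => a j *+ k.+2) = (fun j => a j + a j *+ k.+1).
    by apply/funext => j; rewrite mulrS.
  exact: Qadd.
elim: n s => [|n IH] s s0 sQ.
  exists (fun=> 0) => p ps; rewrite big_ord0; apply: (@Q0 p.1); last exact: sQ.
  by move=> j; apply: s0.
(* When the coefficients at [n] have opposite signs, these multipliers cancel them. *)
pose comb (p q : (nat -> int) * F) : (nat -> int) * F :=
  ((fun j => p.1 j *+ `|q.1 n|%N + q.1 j *+ `|p.1 n|%N),
   p.2 *+ `|q.1 n|%N + q.2 *+ `|p.1 n|%N).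
pose sz := List.filter (fun p => p.1 n == 0) s.
pose sp := List.filter (fun p => 0 < p.1 n) s.
pose sn := List.filter (fun p => p.1 n < 0) s.
pose s' := sz ++ List.flat_map (fun p => List.map (comb p) sn) sp.
have inP p : List.In p s' -> (List.In p s /\ p.1 n = 0) \/
    exists q q', [/\ List.In q s, List.In q' s, 0 < q.1 n, q'.1 n < 0 & p = comb q q'].
  move=> /List.in_app_iff [/List.filter_In [ps /eqP p0]|]; first by left.
  move=> /List.in_flat_map [q [/List.filter_In [qs q0] /List.in_map_iff [q' [<-]]]].
  by move=> /List.filter_In [qs' q0']; right; exists q, q'.
have [||c Hc] := IH s'.
- move=> p j /inP [[ps p0]|[q [q' [qs qs' q0 q0' ->]]]] nj.
    have [<-//|nj'] := eqVneq n j; apply: s0 => //.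
    by rewrite ltn_neqAle nj'.
  have [<-|nj'] := eqVneq n j.
    by rewrite /= -[_ *+ `|q'.1 n|%N]mulr_natr -[_ *+ `|q.1 n|%N]mulr_natr !natr_absz
      (gtr0_norm q0) (ltr0_norm q0') !intz mulrN mulrC addNr.
  have nj2 : (n < j)%N by rewrite ltn_neqAle nj'.
  have q0j : q.1 j = 0 by apply: s0.
  have q0j' : q'.1 j = 0 by apply: s0.
  by rewrite /= q0j q0j' !mul0rn addr0.
- move=> p /inP [[ps p0]|[q [q' [qs qs' q0 q0' ->]]]]; first exact: sQ.
  have pos (z : int) : z != 0 -> exists k, `|z|%N = k.+1.
    by rewrite -absz_gt0; case: `|z|%N => // k _; exists k.
  have [k Ek] := pos _ (lt0r_neq0 q0); have [l El] := pos _ (ltr0_neq0 q0').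
  by rewrite /comb /= Ek El; apply: Qadd; apply: Qmul; apply: sQ.
pose val (p : (nat -> int) * F) := \sum_(j < n) (p.1 j)%:~R * c j : F.
(* With the other unknowns set to [c], the inequality [p] bounds the unknown [n] by this value: from
   above if its coefficient is positive, from below if negative. *)
pose bnd (p : (nat -> int) * F) := (p.2 - val p) / (p.1 n)%:~R.
have cross q q' : List.In q s -> List.In q' s -> 0 < q.1 n -> q'.1 n < 0 -> bnd q' <= bnd q.
  move=> qs qs' q0 q0'.
  have /Hc : List.In (comb q q') s'.
    apply/List.in_app_iff; right; apply/List.in_flat_map; exists q; split.
      by apply/List.filter_In.
    by apply/List.in_map_iff; exists q'; split=> //; apply/List.filter_In.
  set A : F := (q.1 n)%:~R; set B : F := (q'.1 n)%:~R.
  have A0 : 0 < A by rewrite ltr0z.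
  have B0 : 0 < - B by rewrite oppr_gt0 ltrz0.
  have EA (x : F) : x *+ `|q.1 n|%N = x * A.
    by rewrite -mulr_natr natr_absz gtr0_norm.
  have EB (x : F) : x *+ `|q'.1 n|%N = x * - B.
    by rewrite -mulr_natr natr_absz ltr0_norm // rmorphN.
  rewrite /= EA EB.
  have -> : \sum_(j < n) (q.1 j *+ `|q'.1 n|%N + q'.1 j *+ `|q.1 n|%N)%:~R * c j
      = val q * - B + val q' * A.
    rewrite /val !mulr_suml -big_split /=; apply: eq_bigr => j _.
    by rewrite rmorphD !rmorphMn /= EA EB mulrDl !(mulrAC _ (c j)).
  move=> H; rewrite /bnd -/A -/B ler_pdivlMr // -(ler_pM2r B0) mulrN mulrAC divfK.
    by lra.
  by rewrite -oppr_eq0 gt_eqF.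
(* Every lower bound is below every upper bound, so [x] is found by taking the minimum of the upper
   bounds and then the maximum with the lower ones; 0 is the start value and serves when there are
   no bounds. *)
have [x [Hlo Hhi]] : exists x, (forall q, List.In q sn -> bnd q <= x) /\
    (forall q, List.In q sp -> x <= bnd q).
  have {cross} : forall q q', List.In q sp -> List.In q' sn -> bnd q' <= bnd q.
    by move=> q q' /List.filter_In [qs q0] /List.filter_In [qs' q0']; apply: cross.
  elim: (sn) => [|a l IHl] H.
    elim: {H} (sp) => [|b l [x [_ Hx]]]; first by exists 0.
    exists (Num.min x (bnd b)); split=> // q /= [<-|/Hx Hq].
      by rewrite ge_min lexx orbT.
    by rewrite ge_min Hq.
  have [|x [H1 H2]] := IHl; first by move=> q q' qs ql; apply: H => //; right.
  exists (Num.max x (bnd a)); split=> q.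
    by move=> /= [<-|/H1 Hq]; rewrite le_max ?lexx ?orbT // Hq.
  by move=> qs; rewrite ge_max H2 //= H //; left.
exists (fun j => if j == n then x else c j) => p ps.
rewrite big_ord_recr /= eqxx.
have -> : \sum_(i < n) (p.1 i)%:~R * (if i == n :> nat then x else c i) = val p.
  by apply: eq_bigr => j _; rewrite ltn_eqF.
have [pn|pn|pn] := ltgtP (p.1 n) 0.
- have B0 : (p.1 n)%:~R < 0 :> F by rewrite ltrz0.
  have := Hlo p; rewrite /bnd => /(_ _)-/(_ (proj2 (List.filter_In _ _ _) (conj ps pn))).
  by rewrite ler_ndivrMr // mulrC; lra.
- have B0 : 0 < (p.1 n)%:~R :> F by rewrite ltr0z.
  have := Hhi p; rewrite /bnd => /(_ _)-/(_ (proj2 (List.filter_In _ _ _) (conj ps pn))).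
  by rewrite ler_pdivlMr // mulrC; lra.
- rewrite pn mul0r addr0; apply: Hc; apply/List.in_app_iff; left.
  by apply/List.filter_In; rewrite pn.
Qed.

(** * Homogeneous parts of polynomials *)

Section Gradings.
Variable F : fieldType.
Hypothesis char0 : [pchar F] =i pred0.
Variable N : nat.
Implicit Types (p : {mpoly F[N]}) (y : 'I_N -> F).

Definition mgrade (g : 'I_N -> int) (b : 'X_{1..N}) : int := \sum_i (b i)%:Z * g i.

Definition mpart (P : pred 'X_{1..N}) p : {mpoly F[N]} :=
  \sum_(b <- msupp p | P b) p@_b *: 'X_[b].

Lemma mcoeff_mpart P p b : (mpart P p)@_b = if P b then p@_b else 0.
Proof.
rewrite /mpart raddf_sum /= big_mkcond /=.
have E (c : 'X_{1..N}) : (if P c then (p@_c *: 'X_[c])@_b else 0)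
    = (if P b then p@_b else 0) *+ (c == b).
  by have [<-|ne] := eqVneq c b; case: (P c);
    rewrite ?mcoeffZ ?mcoeffX ?eqxx ?mulr1 ?(negbTE ne) ?mulr0.
rewrite (eq_bigr _ (fun c _ => E c)); have [bp|bp] := boolP (b \in msupp p).
  rewrite (bigD1_seq b) //= ?msupp_uniq // eqxx big1 ?addr0 // => c /negbTE -> //.
rewrite big1_seq; last by move=> c /= cp; rewrite (_ : c == b = false) //;
  apply: contraNF bp => /eqP <-.
by rewrite memN_msupp_eq0 // if_same.
Qed.

(** Multiplied by a power of [t], the Laurent polynomial becomes a polynomial vanishing at all
    positive integers, which are distinct in characteristic 0. *)
Lemma laurent_coef (T : eqType) (s : seq T) (e : T -> int) (c : T -> F) (d : int) :
  (forall t : F, t != 0 -> \sum_(b <- s) c b * t ^ e b = 0) ->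
  \sum_(b <- s | e b == d) c b = 0.
Proof.
(* [K] dominates [d] and all exponents, so that after the shift by [K] no absolute value changes
   anything. *)
move=> H; pose K := (`|d| + \sum_(b <- s) `|e b|)%N.
have dK : (`|d| <= K)%N by apply: leq_addr.
have eK b : b \in s -> (`|e b| <= K)%N.
  by move=> bs; rewrite /K (big_rem b) //= addnCA leq_addr.
have absK (z : int) : (`|z| <= K)%N -> (absz (z + K%:Z))%:Z = z + K%:Z.
  by move=> zK; rewrite gez0_abs //; lia.
pose q : {poly F} := \sum_(b <- s) c b *: 'X^(absz (e b + K%:Z)).
have q_eq0 : q = 0.
  apply: (@roots_geq_poly_eq0 _ q [seq k.+1%:R | k <- iota 0 (size q)]).
  - apply/allP => _ /mapP [k _ ->]; rewrite rootE /q horner_sum.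
    have k0 : k.+1%:R != 0 :> F by rewrite (pcharf0P F).1.
    have := H _ k0 => /(congr1 (fun x => x * k.+1%:R ^ K%:Z)).
    rewrite mul0r mulr_suml => E; apply/eqP; rewrite -[RHS]E.
    rewrite !big_seq; apply: eq_bigr => b bs.
    by rewrite hornerZ hornerXn -mulrA -expfzDr // -[in RHS]absK // eK.
  - rewrite map_inj_uniq ?iota_uniq // => a b /eqP; wlog ab : a b / (a <= b)%N.
      by move=> W; have /orP[/W|/W W'] := leq_total a b => //; rewrite eq_sym => /W' ->.
    rewrite eq_sym -subr_eq0 -natrB ?ltnS // subSS (pcharf0P F).1 // subn_eq0 => ba.
    by apply/eqP; rewrite eqn_leq ab.
  - by rewrite size_map size_iota.
have := congr1 (fun h : {poly F} => h`_(absz (d + K%:Z))) q_eq0.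
rewrite /= coef0 /q coef_sum => {2}<-.
rewrite big_mkcond /= !big_seq; apply: eq_bigr => b bs.
rewrite coefZ coefXn; have -> : (absz (d + K%:Z) == absz (e b + K%:Z)) = (e b == d).
  apply/eqP/eqP => [E|->//]; have : (absz (d + K%:Z))%:Z = (absz (e b + K%:Z))%:Z by rewrite E.
  by rewrite !absK // ?eK // => /addIr.
by case: ifP; rewrite ?mulr1 ?mulr0.
Qed.

Lemma meval_scale (t : F) (g : 'I_N -> int) (b : 'X_{1..N}) y : t != 0 ->
  ('X_[b] : {mpoly F[N]}).@[fun i => t ^ g i * y i] = t ^ mgrade g b * 'X_[b].@[y].
Proof.
move=> t0; rewrite !mevalX /mgrade.
have -> : t ^ (\sum_i (b i)%:Z * g i) = \prod_i t ^ ((b i)%:Z * g i).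
  by apply: (big_morph (fun z => t ^ z)) => [u v|]; rewrite ?expr0z // expfzDr.
rewrite -big_split /=; apply: eq_bigr => i _.
by rewrite exprMn [(b i)%:Z * g i]mulrC -exprz_exp.
Qed.

(** Along the orbit of [y] the value of [p] is a Laurent polynomial in [t], and its coefficient at
    [t ^ d] is the value of the part of degree [d] at [y]. *)
Lemma mpart_vanish (S : ('I_N -> F) -> Prop) (g : 'I_N -> int) (d : int) p :
  (forall t y, t != 0 -> S y -> S (fun i => t ^ g i * y i)) ->
  (forall y, S y -> p.@[y] = 0) ->
  forall y, S y -> (mpart (fun b => mgrade g b == d) p).@[y] = 0.
Proof.
move=> Sg pS y Sy; rewrite /mpart raddf_sum /=.
apply: (@laurent_coef _ (msupp p) (mgrade g) (fun b => (p@_b *: 'X_[b]).@[y])) => t t0.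
rewrite -[RHS](pS _ (Sg t y t0 Sy)) [in RHS](mpolyE p) raddf_sum /=.
by apply: eq_bigr => b _; rewrite !mevalZ meval_scale // mulrA mulrAC.
Qed.

Lemma mpart_comp (P Q : pred 'X_{1..N}) p :
  mpart P (mpart Q p) = mpart (fun b => Q b && P b) p.
Proof. by apply/mpolyP => b; rewrite !mcoeff_mpart; case: (Q b); case: (P b). Qed.

Lemma mpart_all_vanish (S : ('I_N -> F) -> Prop) (gs : seq ('I_N -> int))
    (a : 'X_{1..N}) p :
  (forall g, List.In g gs -> forall t y, t != 0 -> S y -> S (fun i => t ^ g i * y i)) ->
  (forall y, S y -> p.@[y] = 0) ->
  forall y, S y ->
    (mpart (fun b => all (fun g => mgrade g b == mgrade g a) gs) p).@[y] = 0.
Proof.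
elim: gs p => [|g gs IH] p Sg pS /=.
  move=> y /pS <-; congr (_.@[_]); apply/mpolyP => b.
  by rewrite mcoeff_mpart.
have pS' := @mpart_vanish S g (mgrade g a) p (Sg g (or_introl erefl)) pS.
have := IH _ (fun g' Hg' => Sg g' (or_intror Hg')) pS'.
by rewrite mpart_comp.
Qed.

(** Grading by every single variable isolates one term of [p], whose value at the all-ones point is
    its coefficient. *)
Lemma mpoly_eq0_of_meval p : (forall y, p.@[y] = 0) -> p = 0.
Proof.
move=> p0; apply/mpolyP => a; rewrite mcoeff0.
pose g (i j : 'I_N) : int := (i == j)%:Z.
have gE i b : mgrade (g i) b = (b i)%:Z.
  rewrite /mgrade (bigD1 i) //= /g eqxx mulr1 big1 ?addr0 // => j ji.
  by rewrite eq_sym (negbTE ji) mulr0.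
have := @mpart_all_vanish (fun=> True) [seq g i | i <- enum 'I_N] a p
  (fun _ _ _ _ _ _ => I) (fun y _ => p0 y) (fun=> 1) I.
have -> : mpart (fun b => all (fun h => mgrade h b == mgrade h a) [seq g i | i <- enum 'I_N]) p
    = p@_a *: 'X_[a].
  apply/mpolyP => b; rewrite mcoeff_mpart mcoeffZ mcoeffX all_map.
  have [<-|ne] := eqVneq a b; first by rewrite mulr1 ifT //; apply/allP => i _ /=.
  rewrite mulr0 ifF //; apply/negP => /allP E; case/eqP: ne; apply/mnmP => i.
  by have := E i (mem_enum _ i); rewrite /= !gE => /eqP [].
by rewrite mevalZ mevalX big1 ?mulr1 // => i _; rewrite expr1n.
Qed.

End Gradings.

(** * Tropical bases of linear spaces *)

Definition wt (R : pzSemiRingType) N (c : 'I_N -> R) (b : 'X_{1..N}) : R :=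
  \sum_i (b i)%:R * c i.

Lemma wtD (R : pzSemiRingType) N (c : 'I_N -> R) (a b : 'X_{1..N}) :
  wt c (a + b)%MM = wt c a + wt c b.
Proof.
by rewrite /wt -big_split; apply: eq_bigr => i _; rewrite mnmDE natrD mulrDl.
Qed.

Section LowPart.
Variables (F : fieldType) (R : realDomainType) (N : nat) (c : 'I_N -> R).
Implicit Types (p q : {mpoly F[N]}) (W : R).

Definition above W p := forall b, b \in msupp p -> W < wt c b.

(** The case [q = 0] is allowed, which makes the relation multiplicative without side conditions;
    that lowest parts do not vanish is checked separately. *)
Definition low_part W p q :=
  (forall b, b \in msupp q -> wt c b = W) /\ above W (p - q).

Lemma above0 W : above W 0.
Proof. by move=> b; rewrite msupp0. Qed.

Lemma aboveD W p q : above W p -> above W q -> above W (p + q).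
Proof. by move=> Hp Hq b /msuppD_le; rewrite mem_cat => /orP[/Hp|/Hq]. Qed.

Lemma low_part_above W W' p q : W < W' -> low_part W' p q -> above W p.
Proof.
move=> WW' [Hq Hpq]; rewrite -(subrK q p); apply: aboveD.
  by move=> b /Hpq; apply: lt_trans.
by move=> b /Hq ->.
Qed.

Lemma low_partM W W' p q p' q' :
  low_part W p q -> low_part W' p' q' -> low_part (W + W') (p * p') (q * q').
Proof.
have mulP (P : 'X_{1..N} -> Prop) (a b : {mpoly F[N]}) :
    (forall x y, x \in msupp a -> y \in msupp b -> P (x + y)%MM) ->
    forall z, z \in msupp (a * b) -> P z.
  by move=> H z /msuppM_le /allpairsP [[x y] [/= xa yb ->]]; apply: H.
move=> [Hq Hpq] [Hq' Hpq']; split.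
  by apply: mulP => x y /Hq <- /Hq' <-; rewrite wtD.
have -> : p * p' - q * q' = (p - q) * (p' - q') + (p - q) * q' + q * (p' - q').
  by rewrite -mulrDr subrK mulrBl mulrBr addrA subrK.
apply: aboveD; first apply: aboveD; apply: mulP => x y xa yb; rewrite wtD.
- by rewrite ltrD // ?Hpq ?Hpq'.
- by rewrite (Hq' _ yb) ltrD2r Hpq.
- by rewrite (Hq _ xa) ltrD2l Hpq'.
Qed.

Lemma low_part1 : low_part 0 1 1.
Proof.
split; last by rewrite subrr; apply: above0.
move=> b; rewrite msupp1 inE => /eqP ->.
by rewrite /wt big1 // => i _; rewrite mnm0E mul0r.
Qed.

Lemma low_partX W p q k : low_part W p q -> low_part (k%:R * W) (p ^+ k) (q ^+ k).
Proof.
move=> H; elim: k => [|k IH]; first by rewrite mul0r; apply: low_part1.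
by rewrite !exprS -natr1 mulrDl mul1r addrC; apply: low_partM.
Qed.

Lemma low_part_prod (I : Type) (s : seq I) (W : I -> R) (p_ q_ : I -> {mpoly F[N]}) :
  (forall i, low_part (W i) (p_ i) (q_ i)) ->
  low_part (\sum_(i <- s) W i) (\prod_(i <- s) p_ i) (\prod_(i <- s) q_ i).
Proof.
move=> H; elim: s => [|i s IH]; first by rewrite !big_nil; apply: low_part1.
by rewrite !big_cons; apply: low_partM.
Qed.

Lemma low_partZ W a p q : low_part W p q -> low_part W (a *: p) (a *: q).
Proof.
move=> [Hq Hpq]; split; first by move=> b /msuppZ_le /Hq.
by rewrite -scalerBr => b /msuppZ_le /Hpq.
Qed.

Lemma low_part0 W q : low_part W 0 q -> q = 0.
Proof.
move=> [Hq]; rewrite sub0r => Hpq; apply: msuppnil0.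
case E: (msupp q) => [//|b l]; have bq : b \in msupp q by rewrite E mem_head.
by have := Hpq b; rewrite (perm_mem (msuppN q)) (Hq _ bq) ltxx => /(_ bq).
Qed.

Lemma wt1 i : wt c U_(i)%MM = c i.
Proof.
rewrite /wt (bigD1 i) //= mnm1E eqxx mul1r big1 ?addr0 // => j ji.
by rewrite mnm1E eq_sym (negbTE ji) mul0r.
Qed.

Lemma low_part_linear W (a : 'I_N -> F) :
  (forall i, a i != 0 -> W <= c i) ->
  low_part W (\sum_i a i *: 'X_i) (\sum_(i | c i == W) a i *: 'X_i).
Proof.
move=> H.
have supp (P : pred 'I_N) b : b \in msupp (\sum_(i | P i) a i *: 'X_i : {mpoly F[N]}) ->
    exists i, [/\ P i, a i != 0 & b = U_(i)%MM].
  move: b; apply: (big_ind (fun q : {mpoly F[N]} => forall b, b \in msupp q ->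
    exists i, [/\ P i, a i != 0 & b = U_(i)%MM])).
  - by move=> b; rewrite msupp0.
  - by move=> q q' Hq Hq' b /msuppD_le; rewrite mem_cat => /orP[/Hq|/Hq'].
  move=> i Pi b; have [->|ai] := eqVneq (a i) 0; first by rewrite scale0r msupp0.
  by rewrite msuppMCX // inE => /eqP ->; exists i.
split; first by move=> b /supp [i [/eqP <- _ ->]]; rewrite wt1.
rewrite [X in X - _](bigID (fun i => c i == W)) /= [X in X - _]addrC addrK.
by move=> b /supp [i [ci ai ->]]; rewrite wt1 lt_neqAle eq_sym ci H.
Qed.

End LowPart.

Section LinearTropicalBasis.
Variables (F : fieldType) (R : realDomainType).
Hypothesis char0 : [pchar F] =i pred0.

(** Choose an invertible set of columns [f] of maximal total weight and normalize it to the
    identity. A nonzero entry in row [a] and column [i] allows [f a] to be exchanged for [i], so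
    maximality gives [b i <= b (f a)]. *)
Lemma max_weight_basis (d M : nat) (A : 'M[F]_(d, M)) (b : 'I_M -> R) : row_free A ->
  exists (f : 'I_d -> 'I_M) (P B : 'M[F]_(d, d)),
    [/\ P *m B = 1%:M, forall a a', (P *m A) a (f a') = (a == a')%:R
      & forall a i, (P *m A) a i != 0 -> b i <= b (f a)].
Proof.
move=> freeA.
have fullA : row_full A^T by rewrite /row_full mxrank_tr.
pose ok (f : {ffun 'I_d -> 'I_M}) := colsub f A \in unitmx.
have ok0 : ok (fullrankfun fullA).
  rewrite /ok -unitmx_tr; have := fullrowsub_unit fullA.
  by congr (_ \in unitmx); apply/matrixP => i j; rewrite !mxE.
have [f okf maxf] := Order.TotalTheory.arg_maxP (fun f : {ffun 'I_d -> 'I_M} => \sum_a b (f a)) ok0.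
pose P := invmx (colsub f A).
have PA a a' : (P *m A) a (f a') = (a == a')%:R.
  have := congr1 (fun X : 'M_d => X a a') (mulVmx okf); rewrite !mxE => <-.
  by apply: eq_bigr => k _; rewrite !mxE.
exists f, P, (colsub f A); split=> //; first exact: mulVmx.
move=> a i nz.
pose f' := [ffun a' => if a' == a then i else f a'].
(* In the normalized matrix, the columns of [f'] other than [a] are unit vectors and column [a] has
   a nonzero entry in row [a], so a vector killed by all of them is zero. *)
have okf' : ok f'.
  rewrite /ok -row_free_unit; apply: inj_row_free => v v0.
  have v1 : (v *m colsub f A) *m colsub f' (P *m A) = 0.
    have -> : colsub f' (P *m A) = P *m colsub f' A.
      by apply/matrixP => x y; rewrite !mxE; apply: eq_bigr => k _; rewrite !mxE.
    by rewrite mulmxA -(mulmxA v) mulmxV // mulmx1.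
  suff : v *m colsub f A = 0.
    by move=> /(congr1 (mulmx^~ P));
      rewrite -mulmxA mulmxV // mulmx1 mul0mx.
  move: v1; set u := v *m _ => u0.
  have cE k a' : colsub f' (P *m A) k a' = (P *m A) k (f' a') by rewrite [LHS]mxE.
  have ua a' : a' != a -> u ord0 a' = 0.
    move=> aa'; have := congr1 (fun X : 'rV_d => X ord0 a') u0; rewrite [LHS]mxE [RHS]mxE.
    rewrite (bigD1 a') //= big1 ?addr0 => [|k ka].
      by rewrite cE ffunE (negbTE aa') PA eqxx mulr1.
    by rewrite cE ffunE (negbTE aa') PA (negbTE ka) mulr0.
  apply/rowP => a'; rewrite [RHS]mxE; have [->|/ua //] := eqVneq a' a.
  have := congr1 (fun X : 'rV_d => X ord0 a) u0; rewrite [LHS]mxE [RHS]mxE.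
  rewrite (bigD1 a) //= big1 ?addr0 => [|k ka]; last by rewrite ua // mul0r.
  by rewrite cE ffunE eqxx => /eqP; rewrite mulf_eq0 (negbTE nz) orbF => /eqP.
have : \sum_k b (f' k) <= \sum_k b (f k) := maxf _ okf'.
rewrite [leLHS](bigD1 a) //= [leRHS](bigD1 a) //= ffunE eqxx.
rewrite (eq_bigr (fun k => b (f k))) ?lerD2r // => k /negbTE ka.
by rewrite ffunE ka.
Qed.

Definition min_twice M (b : 'I_M -> R) (a : 'I_M -> F) : Prop :=
  exists i l, [/\ i != l, a i != 0, a l != 0 &
    forall j, a j != 0 -> b i <= b j /\ b l <= b j].

(* The valuation [low_part] on a polynomial ring parametrizing the linear space
   gives each coordinate the prescribed weight, so a unique lowest term cannot cancel. *)
Lemma linear_tropical_basis (d M : nat) (A : 'M[F]_(d, M)) (b : 'I_M -> R) :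
  row_free A ->
  (forall a : 'I_M -> F, (forall x, \sum_i a i * A x i = 0) ->
     (exists i, a i != 0) -> min_twice b a) ->
  forall p : {mpoly F[M]}, (forall s : 'rV_d, p.@[(s *m A) ord0] = 0) ->
  forall al, al \in msupp p ->
    ~ (forall be, be \in msupp p -> be != al -> wt b al < wt b be).
Proof.
move=> freeA H p p0 al alp uniq_al.
have [f [P [B [PB PA maxP]]]] := max_weight_basis b freeA.
(* For [i] outside the image of [f], the form expressing coordinate [i] through the coordinates
   [f a] vanishes on the row space. Its minimum is attained twice, hence at some [f a] of weight at
   most [b i], and [maxP] gives the opposite inequality. *)
have attained i : exists2 a, (P *m A) a i != 0 & b (f a) = b i.
  have [|nimg] := boolP [exists a, f a == i].
    by move=> /existsP [a /eqP <-]; exists a; rewrite // PA eqxx oner_neq0.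
  pose rel k := (k == i)%:R - \sum_(a | f a == k) (P *m A) a i.
  have rel_i : rel i = 1.
    rewrite /rel eqxx big_pred0 ?subr0 // => a.
    by apply: contraNF nimg => fa; apply/existsP; exists a.
  have relA x : \sum_k rel k * A x k = 0.
    have relPA a : \sum_k rel k * (P *m A) a k = 0.
      have E : \sum_k \sum_(a' | f a' == k) (P *m A) a' i * (P *m A) a k = (P *m A) a i.
        rewrite (exchange_big_dep xpredT) //= (bigD1 a) //= [X in _ + X]big1 ?addr0.
          by rewrite (big_pred1 (f a)) ?PA ?eqxx ?mulr1 // => k; rewrite eq_sym.
        move=> a' a'a; rewrite (big_pred1 (f a')); last by move=> k; rewrite eq_sym.
        by rewrite PA eq_sym (negbTE a'a) mulr0.
      rewrite /rel (eq_bigr (fun k => (k == i)%:R * (P *m A) a k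
        - \sum_(a' | f a' == k) (P *m A) a' i * (P *m A) a k)); last first.
        by move=> k _; rewrite mulrBl mulr_suml.
      rewrite sumrB E (bigD1 i) //= eqxx mul1r big1 ?addr0 ?subrr // => k /negbTE ->.
      by rewrite mul0r.
    have -> : A = B *m (P *m A) by rewrite mulmxA (mulmx1C PB) mul1mx.
    rewrite (eq_bigr (fun k => \sum_a B x a * (rel k * (P *m A) a k))); last first.
      by move=> k _; rewrite mxE mulr_sumr; apply: eq_bigr => a _; rewrite mulrCA.
    rewrite exchange_big big1 // => a _.
    by rewrite -mulr_sumr relPA mulr0.
  have rel_n0 : rel i != 0 by rewrite rel_i oner_neq0.
  have [k [l [kl rk rl Hmin]]] := H rel relA (ex_intro _ i rel_n0).
  have use j : j != i -> rel j != 0 -> b j <= b i -> exists2 a, (P *m A) a i != 0 & b (f a) = b i.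
    move=> /negbTE ji; rewrite /rel ji sub0r oppr_eq0 => /eqP/eqP nz bji.
    have : [exists a, (f a == j) && ((P *m A) a i != 0)].
      apply: contraNT nz; rewrite negb_exists => /forallP z.
      rewrite big1 // => a faj; have := z a.
      by rewrite faj /= negbK => /eqP.
    move=> /existsP [a /andP[/eqP fa nza]]; exists a => //.
    by apply/eqP; rewrite eq_le maxP // fa bji.
  have [bki bli] := Hmin i rel_n0.
  have [ki|ki] := eqVneq k i; last exact: (use k).
  by apply: (use l) => //; rewrite -ki eq_sym.
(* The rows of [P *m A] parametrize the space: [ell i] is coordinate [i] as a linear form in the
   parameters, and giving parameter [a] the weight of [f a] makes [low i] its part of weight [b i],
   nonzero by [attained]. *)
pose c a := b (f a).
pose ell i : {mpoly F[d]} := \sum_a (P *m A) a i *: 'X_a.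
pose low i : {mpoly F[d]} := \sum_(a | c a == b i) (P *m A) a i *: 'X_a.
have low_ell i : low_part c (b i) (ell i) (low i).
  by apply: low_part_linear => a; apply: maxP.
have low_n0 i : low i != 0.
  have [a nza ca] := attained i; apply: contraNneq nza => low0.
  have := congr1 (mcoeff U_(a)%MM) low0; rewrite mcoeff0 raddf_sum /= (bigD1 a) /=; last exact/eqP.
  rewrite mcoeffZ mcoeffX eqxx mulr1 big1 ?addr0 => [->//|k /andP[_ ka]].
  by rewrite mcoeffZ mcoeffX eq_mnm1 (negbTE ka) mulr0.
pose mon (h : 'I_M -> {mpoly F[d]}) (be : 'X_{1..M}) := \prod_i h i ^+ be i.
have low_mon be : low_part c (wt b be) (mon ell be) (mon low be).
  by apply: low_part_prod => i; apply: low_partX.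
have G0 : \sum_(be <- msupp p) p@_be *: mon ell be = 0.
  apply: (mpoly_eq0_of_meval char0) => s; pose v := (\row_a s a) *m P : 'rV_d.
  rewrite -[RHS](p0 v) [in RHS]mevalE raddf_sum /=; apply: eq_bigr => be _.
  rewrite mevalZ rmorph_prod; congr (_ * _); apply: eq_bigr => i _.
  rewrite rmorphXn /=; congr (_ ^+ _); rewrite raddf_sum -mulmxA [RHS]mxE.
  apply: eq_bigr => a _; by rewrite /= mevalZ mevalXU [in RHS]mxE mulrC.
(* In the zero polynomial [G0] all terms other than [al] have higher weight, so the lowest part of
   the term [al] must vanish, yet it is a nonzero scalar times a product of nonzero polynomials. *)
have := low_partZ p@_al (low_mon al).
have -> : p@_al *: mon ell al = 0 - \sum_(be <- msupp p | be != al) p@_be *: mon ell be.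
  move: G0; rewrite (bigD1_seq al) ?msupp_uniq //= => /eqP.
  by rewrite addr_eq0 => /eqP ->; rewrite sub0r.
move=> [Hq Hpq].
have /low_part0 : low_part c (wt b al) 0 (p@_al *: mon low al).
  split=> //.
  have -> : 0 - p@_al *: mon low al =
    (0 - \sum_(be <- msupp p | be != al) p@_be *: mon ell be) - p@_al *: mon low al
      + \sum_(be <- msupp p | be != al) p@_be *: mon ell be.
    by rewrite addrAC addrNK.
  apply: aboveD => //; rewrite big_seq_cond.
  apply: (big_ind (above c (wt b al))); [exact: above0 | exact: aboveD |].
  move=> be /andP[bep ne]; apply: (low_part_above (uniq_al _ bep ne)).
  exact: (low_partZ p@_be (low_mon be)).
move=> /eqP; rewrite scaler_eq0; apply/negP; rewrite negb_or -mcoeff_msupp alp.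
by apply/prodf_neq0 => i _; rewrite expf_neq0.
Qed.

End LinearTropicalBasis.

(** * The kernel and the cone *)

Section NewtonBases.
Variable F : comPzRingType.

Definition newton (e : nat -> F) (b : nat) (t : F) : F := \prod_(l < b) (t - e l).

Lemma newton_span (d e : nat -> F) (b : nat) :
  exists s : nat -> F, forall t, newton e b t = \sum_(c < b.+1) s c * newton d c t.
Proof.
elim: b => [|b [s Hs]].
  by exists (fun=> 1) => t; rewrite big_ord1 mul1r /newton !big_ord0.
(* Splitting [t - e b] as [(t - d c) + (d c - e b)] sends the basis element [c] to contributions at
   [c.+1] and at [c]. *)
exists (fun c => (if c is c'.+1 then s c' else 0)
  + (if (c <= b)%N then s c * (d c - e b) else 0)) => t.
have -> : newton e b.+1 t = newton e b t * (t - e b) by rewrite /newton big_ord_recr.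
rewrite Hs mulr_suml (eq_bigr (fun c : 'I_b.+1 =>
  s c * newton d c.+1 t + s c * (d c - e b) * newton d c t)); last first.
  move=> c _; have -> : newton d c.+1 t = newton d c t * (t - d c).
    by rewrite /newton big_ord_recr.
  by rewrite [s c * (d c - _) * _]mulrAC mulrA -mulrDr addrA subrK.
rewrite [RHS](eq_bigr (fun c : 'I_b.+2 => (if c : nat is c'.+1 then s c' else 0) * newton d c t
  + (if (c <= b)%N then s c * (d c - e b) else 0) * newton d c t)); last first.
  by move=> c _; rewrite mulrDl.
rewrite !big_split /= [X in _ = X + _]big_ord_recl mul0r add0r.
rewrite [X in _ = _ + X]big_ord_recr /= ltnn mul0r addr0; congr (_ + _).
by apply: eq_bigr => c _; rewrite -ltnS ltn_ord.
Qed.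

(** Expanding each factor in the other Newton basis only produces multi-indices bounded by [be]
    coordinatewise, hence still of degree at most [k]. *)
Lemma newton_moments (I : finType) (n k : nat) (d e : nat -> F) (z : I -> F)
    (t : I -> 'I_n -> F) :
  (forall be, deg_le be k -> \sum_i z i * \prod_(j < n) newton d (be j) (t i j) = 0) ->
  forall be, deg_le be k -> \sum_i z i * \prod_(j < n) newton e (be j) (t i j) = 0.
Proof.
move=> H be be_k; have [s Hs] := choice (newton_span d e).
have be_j j : (be j <= k)%N by apply: leq_trans be_k; rewrite (bigD1 j) //= leq_addr.
(* Coefficients are extended by zero to a range common to all [j], so that the product of sums
   expands over functions into ['I_k.+1]. *)
pose S j c := if (c <= be j)%N then s (be j) c else 0.
have E j x : newton e (be j) x = \sum_(c < k.+1) S j c * newton d c x.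
  rewrite Hs (big_ord_widen k.+1 (fun c => s (be j) c * newton d c x)) ?ltnS //.
  rewrite big_mkcond; apply: eq_bigr => c _; rewrite /S ltnS.
  by case: ifP => _; rewrite ?mul0r.
rewrite (eq_bigr (fun i => \sum_(f : {ffun 'I_n -> 'I_k.+1})
  (\prod_j S j (f j)) * (z i * \prod_j newton d (f j) (t i j)))); last first.
  move=> i _; rewrite (eq_bigr _ (fun j _ => E j (t i j))) bigA_distr_bigA mulr_sumr.
  by apply: eq_bigr => f _; rewrite big_split mulrCA.
rewrite exchange_big big1 // => f _; rewrite -mulr_sumr.
have [fle|] := boolP [forall j, (f j <= be j)%N].
  rewrite (H (fun j => f j)) ?mulr0 //; apply: leq_trans be_k.
  by apply: leq_sum => j _; apply: (forallP fle).
rewrite negb_forall => /existsP [j nle].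
by rewrite (bigD1 j) //= /S (negbTE nle) !mul0r.
Qed.

End NewtonBases.

Section KernelAndCone.
Variables (n m k : nat) (r : 'I_m.+1 -> 'I_n -> int).

Lemma ffact_intE (z : int) b :
  (ffact_int z b)%:~R = newton (fun l => l%:R) b (z%:~R : CC).
Proof.
rewrite /ffact_int big_mkord rmorph_prod; apply: eq_bigr => l _.
by rewrite rmorphB.
Qed.

Lemma exprz_intE (z : int) b : (z ^+ b)%:~R = newton (fun=> 0) b (z%:~R : CC).
Proof.
by rewrite /newton (eq_bigr _ (fun _ _ => subr0 _)) prodr_const card_ord rmorphXn.
Qed.

(** Powers and falling factorials are the Newton bases with nodes [0] and [l], so they impose the
    same conditions up to degree [k]. The second form is the Taylor condition at the point with all
    coordinates 1. *)
Lemma kerAk_ffact (z : 'I_m.+1 -> CC) : kerAk k r z <->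
  forall be, deg_le be k -> \sum_i z i * \prod_(j < n) (ffact_int (r i j) (be j))%:~R = 0.
Proof.
have pw be i : (\prod_(j < n) r i j ^+ be j)%:~R
    = \prod_(j < n) newton (fun=> 0) (be j) ((r i j)%:~R : CC).
  by rewrite rmorph_prod; apply: eq_bigr => j _; apply: exprz_intE.
have ff be i : \prod_(j < n) (ffact_int (r i j) (be j))%:~R
    = \prod_(j < n) newton (fun l => l%:R) (be j) ((r i j)%:~R : CC).
  by apply: eq_bigr => j _; rewrite ffact_intE.
split=> H be be_k.
  rewrite (eq_bigr _ (fun i _ => congr1 (GRing.mul (z i)) (ff be i))).
  apply: (newton_moments (d := fun=> 0)) be_k => be' be'_k.
  by rewrite -[RHS](H _ be'_k); apply: eq_bigr => i _; rewrite pw mulrC.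
rewrite (eq_bigr (fun i => z i * \prod_(j < n) newton (fun=> 0) (be j) (r i j)%:~R)).
  apply: (newton_moments (d := fun l => l%:R)) be_k => be' be'_k.
  by rewrite -[RHS](H _ be'_k); apply: eq_bigr => i _; rewrite ff.
by move=> i _; rewrite pw mulrC.
Qed.

Lemma kdual_coneP (y : 'I_m.+1 -> CC) : kdual_cone k r y <->
  exists2 x : 'I_n -> CC, (forall j, x j != 0) &
    kerAk k r (fun i => y i * \prod_(j < n) x j ^ r i j).
Proof.
(* The derivative of a monomial at [x] is its value there times falling factorials times a nonzero
   factor that is the same for all [i]. *)
have E x be : (forall j, x j != 0) -> \sum_(i < m.+1) y i * dlaurent (r i) be x
   = (\sum_i (y i * \prod_(j < n) x j ^ r i j) * \prod_(j < n) (ffact_int (r i j) (be j))%:~R)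
     * \prod_(j < n) x j ^ (- (be j)%:Z).
  move=> x0; rewrite mulr_suml; apply: eq_bigr => i _.
  rewrite -!mulrA; congr (_ * _); rewrite -!big_split; apply: eq_bigr => j _.
  by rewrite /= expfzDr // mulrCA.
split=> [[x [x0 H]]|[x x0 /kerAk_ffact H]]; exists x => //.
  apply/kerAk_ffact => be /H; rewrite E // => /eqP; rewrite mulf_eq0 => /orP[/eqP //|].
  by rewrite prodf_seq_eq0 => /hasP [j _]; rewrite /= expfz_eq0 (negbTE (x0 j)) andbF.
by split=> // be be_k; rewrite E // H // mul0r.
Qed.

Lemma kerAk_row_space : exists (d : nat) (A : 'M[CC]_(d, m.+1)), row_free A /\
  forall y, kerAk k r y <-> exists s : 'rV_d, y = (s *m A) ord0.
Proof.
pose I := {ffun 'I_n -> 'I_k.+1}.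
(* Multi-indices of degree above [k] get a zero column, which imposes no condition. *)
pose coef (f : I) i : CC := if deg_le (fun j => f j) k then (\prod_(j < n) r i j ^+ f j)%:~R else 0.
pose Q : 'M[CC]_(m.+1, #|I|) := \matrix_(i, f) coef (enum_val f) i.
exists (\rank (kermx Q)), (row_base (kermx Q)); split; first exact: row_base_free.
move=> y; pose v : 'rV[CC]_m.+1 := \row_i y i.
have vy : v ord0 = y by apply/funext => i; rewrite mxE.
have -> : kerAk k r y <-> v *m Q = 0.
  split=> [H|H be be_k].
    apply/rowP => f; rewrite !mxE.
    have [fk|/negbTE fk] := boolP (deg_le (fun j => (enum_val f : I) j) k).
      by rewrite -[RHS](H _ fk); apply: eq_bigr => i _; rewrite !mxE /coef fk mulrC.
    by rewrite big1 // => i _; rewrite !mxE /coef fk mulr0.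
  have be_j j : (be j < k.+1)%N.
    by rewrite ltnS; apply: leq_trans be_k; rewrite (bigD1 j) //= leq_addr.
  pose f : I := [ffun j => Ordinal (be_j j)].
  have fE : (fun j => f j : nat) = be by apply/funext => j; rewrite ffunE.
  have := congr1 (fun X : 'rV_#|I| => X ord0 (enum_rank f)) H; rewrite !mxE => {2}<-.
  apply: eq_bigr => i _; rewrite !mxE /coef enum_rankK fE be_k mulrC; congr (_ * _%:~R).
  by apply: eq_bigr => j _; rewrite ffunE.
split=> [/sub_kermxP|[s E]].
  by rewrite -(eq_row_base (kermx Q)) => /submxP [s E]; exists s; rewrite -E vy.
have -> : v = s *m row_base (kermx Q) by apply/rowP => i; rewrite mxE E.
by apply/sub_kermxP; rewrite (submx_trans (submxMl _ _)) // eq_row_base.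
Qed.

End KernelAndCone.

(** * Lifting weights *)

Lemma list_inP (T : eqType) (x : T) (s : seq T) : List.In x s <-> x \in s.
Proof.
elim: s => [//|a s IH] /=; rewrite inE; split=> [[->|/IH ->]|/orP[/eqP ->|/IH]].
- by rewrite eqxx.
- by rewrite orbT.
- by left.
- by right.
Qed.

Lemma total_minimum (T : eqType) (le : T -> T -> Prop) (s : seq T) :
  (forall a b, le a b \/ le b a) -> (forall a b c, le a b -> le b c -> le a c) ->
  s != [::] -> exists2 l, l \in s & forall i, i \in s -> le l i.
Proof.
move=> tot tr; have refl a : le a a by case: (tot a a).
elim: s => [//|a [|b s] IH] _.
  by exists a; rewrite ?inE // => i; rewrite inE => /eqP ->.
have [//|l ls Hl] := IH; have [al|la] := tot a l.
  exists a; first exact: mem_head.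
  by move=> i; rewrite inE => /orP[/eqP -> //|/Hl]; apply: tr.
exists l; first by rewrite inE ls orbT.
by move=> i; rewrite inE => /orP[/eqP -> //|/Hl].
Qed.

Lemma mgradeD N (g : 'I_N -> int) (a b : 'X_{1..N}) :
  mgrade g (a + b)%MM = mgrade g a + mgrade g b.
Proof.
by rewrite /mgrade -big_split; apply: eq_bigr => i _; rewrite mnmDE PoszD mulrDl.
Qed.

Lemma msuppM_ind (F : fieldType) N (P : 'X_{1..N} -> Prop) (p q : {mpoly F[N]}) :
  (forall x y, x \in msupp p -> y \in msupp q -> P (x + y)%MM) ->
  forall z, z \in msupp (p * q) -> P z.
Proof. by move=> H z /msuppM_le /allpairsP [[x y] [/= xp yq ->]]; apply: H. Qed.

Section WeightLifting.
Variables (F : fieldType) (R : realFieldType) (n M : nat).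
Variables (K : ('I_M -> F) -> Prop) (r : 'I_M -> 'I_n -> int) (w : 'I_M -> R).

Definition same_grade (a b : 'X_{1..M}) : Prop :=
  forall j, mgrade (fun i => r i j) a = mgrade (fun i => r i j) b.

(** For [K] the kernel, this is what membership of [w] in the tropicalization of the cone provides:
    a homogeneous polynomial vanishing on the kernel vanishes on the cone. *)
Hypothesis no_unique_min : forall (p : {mpoly F[M]}) (al : 'X_{1..M}),
  (forall y, K y -> p.@[y] = 0) -> al \in msupp p ->
  (forall be, be \in msupp p -> same_grade be al) ->
  ~ (forall be, be \in msupp p -> be != al -> wt w al < wt w be).

Let U : Type := {y : 'I_M -> F | K y /\ forall i, y i != 0}.
Let fn : Type := U -> F.
Let ev (p : {mpoly F[M]}) : fn := fun u => p.@[sval u].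
Let nz (u : U) i : sval u i != 0. Proof. by case: u => y [_ y0] /=. Qed.

(* Degree-zero Laurent polynomials of positive [w]-weight, as functions on the torus
   part of [K]; a denominator [X^N] is cleared to stay with ordinary polynomials. *)
Definition positive_part (f : fn) : Prop :=
  exists (N : 'X_{1..M}) (p : {mpoly F[M]}), f * ev 'X_[N] = ev p /\
    forall be, be \in msupp p -> same_grade be N /\ wt w N < wt w be.

Definition scalar (f : fn) : Prop := exists c : F, f = fun=> c.

Let evD p q : ev (p + q) = ev p + ev q.
Proof. by apply/funext => u; rewrite /ev mevalD. Qed.
Let evM p q : ev (p * q) = ev p * ev q.
Proof. by apply/funext => u; rewrite /ev mevalM. Qed.

Let same_gradeD a b a' b' :
  same_grade a a' -> same_grade b b' -> same_grade (a + b)%MM (a' + b')%MM.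
Proof. by move=> Ha Hb j; rewrite !mgradeD Ha Hb. Qed.

Lemma positive_part0 : positive_part 0.
Proof.
exists 0%MM, 0; split; last by move=> be; rewrite msupp0.
by apply/funext => u; rewrite /ev mul0r meval0.
Qed.

Lemma positive_part_subring : nonunital_subring scalar positive_part.
Proof.
have mulX (p : {mpoly F[M]}) N N' :
    (forall be, be \in msupp p -> same_grade be N /\ wt w N < wt w be) ->
    forall be, be \in msupp (p * 'X_[N']) ->
      same_grade be (N + N')%MM /\ wt w (N + N')%MM < wt w be.
  move=> H; apply: msuppM_ind => x y /H [gx wx]; rewrite msuppX inE => /eqP ->.
  by split; [exact: same_gradeD | rewrite !wtD ltrD2r].
split.
- move=> f g [N [p [fp Hp]]] [N' [q [gq Hq]]].
  exists (N + N')%MM, (p * 'X_[N'] + q * 'X_[N]); split.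
    by rewrite mpolyXD !evM evD !evM -fp -gq mulrDl mulrA [ev 'X_[N] * _]mulrC mulrA.
  move=> be /msuppD_le; rewrite mem_cat => /orP[]; first exact: mulX.
  by rewrite addmC; apply: mulX.
- move=> f g [N [p [fp Hp]]] [N' [q [gq Hq]]].
  exists (N + N')%MM, (p * q); split; first by rewrite mpolyXD !evM -fp -gq mulrACA.
  apply: msuppM_ind => x y /Hp [gx wx] /Hq [gy wy]; rewrite !wtD.
  by split; [exact: same_gradeD | rewrite ltrD].
- move=> _ f [c ->] [N [p [fp Hp]]]; exists N, (c *: p); split.
    by rewrite -mulrA fp; apply/funext => u; rewrite /ev mevalZ.
  by move=> be /msuppZ_le; apply: Hp.
Qed.

(** Otherwise some ['X_[N] - p] vanishes on the torus part of [K] with [N] its only term of least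
    weight. The product with all variables vanishes on the whole of [K], against [no_unique_min]. *)
Lemma positive_part1 : ~ positive_part 1.
Proof.
move=> [N [p [E Hp]]]; pose ones : 'X_{1..M} := [multinom 1%N | i < M].
have onesE y : ('X_[ones] : {mpoly F[M]}).@[y] = \prod_i y i.
  by rewrite mevalX; apply: eq_bigr => i _; rewrite mnmE.
have pN : p@_N = 0.
  by apply/eqP; apply: contraT; rewrite -mcoeff_msupp => /Hp [_]; rewrite ltxx.
have supp be : be \in msupp ('X_[N] - p) -> be = N \/ be \in msupp p.
  move=> /msuppB_le; rewrite mem_cat msuppX inE => /orP[/eqP|]; by [left|right].
have suppX be : be \in msupp (('X_[N] - p) * 'X_[ones]) ->
    exists2 ga, be = (ga + ones)%MM & ga \in msupp ('X_[N] - p).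
  move: be; apply: msuppM_ind => x y xs; rewrite msuppX inE => /eqP ->; by exists x.
apply: (@no_unique_min (('X_[N] - p) * 'X_[ones]) (N + ones)%MM).
- move=> y Ky; rewrite mevalM onesE.
  have [nzy|] := boolP [forall i, y i != 0].
    pose u : U := exist _ y (conj Ky (fun i => forallP nzy i)).
    have := congr1 (fun f : fn => f u) E; rewrite mul1r /ev /= mevalB => ->.
    by rewrite subrr mul0r.
  rewrite negb_forall => /existsP [i /negPn/eqP yi].
  by rewrite [X in _ * X](bigD1 i) //= yi mul0r mulr0.
- by rewrite mcoeff_msupp addmC mcoeffMX mcoeffB mcoeffX eqxx pN subr0 oner_neq0.
- move=> be /suppX [ga -> /supp [->//|/Hp [gN _]]].
  exact: same_gradeD.
- move=> be /suppX [ga -> /supp [->|/Hp [_ wN] _]]; first by rewrite eqxx.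
  by rewrite !wtD ltrD2r.
Qed.

Let laurent (e : 'I_M -> int) : fn := fun u => \prod_i sval u i ^ e i.

Let laurentD e e' : laurent (fun i => e i + e' i) = laurent e * laurent e'.
Proof.
apply/funext => u; rewrite /laurent mulrfctE -big_split; apply: eq_bigr => i _.
by rewrite /= expfzDr ?nz.
Qed.

Let laurentN e : laurent e * laurent (fun i => - e i) = 1.
Proof.
rewrite -laurentD; apply/funext => u; apply: big1 => i _.
by rewrite subrr expr0z.
Qed.

Lemma positive_part_laurent (e : 'I_M -> int) :
  (forall j, \sum_i e i * r i j = 0) -> 0 < \sum_i (e i)%:~R * w i ->
  positive_part (laurent e).
Proof.
move=> er ew.
(* [N] collects the negative exponents of [e] and [N'] the others. *)
pose N : 'X_{1..M} := [multinom (if (e i < 0)%R then absz (e i) else 0%N) | i < M].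
pose N' : 'X_{1..M} := [multinom (if (e i < 0)%R then 0%N else absz (e i)) | i < M].
have NE i : (N' i)%:Z = e i + (N i)%:Z by rewrite !mnmE; case: ifP; lia.
exists N, 'X_[N']; split.
  apply/funext => u; rewrite /ev mulrfctE !mevalX -big_split; apply: eq_bigr => i _.
  by rewrite /= -[LHS]/(_ * sval u i ^ (N i)%:Z) -expfzDr ?nz // -NE.
move=> be; rewrite msuppX inE => /eqP ->; split.
  move=> j; rewrite /mgrade (eq_bigr (fun i => e i * r i j + (N i)%:Z * r i j)).
    by rewrite big_split /= er add0r.
  by move=> i _; rewrite NE mulrDl.
rewrite -subr_gt0 /wt -sumrB (eq_bigr (fun i => (e i)%:~R * w i)) // => i _.
by rewrite -mulrBl; congr (_ * _); rewrite -[(N' i)%:R]/((N' i)%:Z%:~R) NE rmorphD /= addrK.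
Qed.

(* The valuation obtained from [maximal_avoids_one] need not have rank one: only
   its preorder on the coordinates is used, and Farkas turns it into real weights. *)
Lemma weight_lifting : exists c : 'I_n -> R, forall a : 'I_M -> F,
  (forall y, K y -> \sum_i a i * y i = 0) -> (exists i, a i != 0) ->
  min_twice (fun i => w i + \sum_j (r i j)%:~R * c j) a.
Proof.
have DN1 : scalar (-1) by exists (-1).
have [P [avP maxP]] := maximal_avoids_one positive_part0 positive_part_subring positive_part1.
have [[Padd Pmul Pscale] PM0 P1] := avP.
pose V := idealizer P.
have Vsum (I : Type) (s : seq I) (Q : pred I) (f : I -> fn) :
    (forall i, Q i -> P (f i)) -> P (\sum_(i <- s | Q i) f i).
  by move=> Pf; apply: big_ind => //; exact: PM0 positive_part0.
pose ratio i l : fn := fun u => sval u l / sval u i.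
have ratioV i l : ratio i l * ratio l i = 1.
  apply/funext => u; rewrite /ratio mulrfctE.
  by rewrite mulrA divfK ?nz // divff ?nz.
(* In terms of the valuation, coordinate [i] has value at most that of coordinate [l]. *)
pose le i l := V (ratio i l).
have le_total i l : le i l \/ le l i.
  exact: (idealizer_or_inv DN1 positive_part0 avP maxP (ratioV i l)).
have le_trans a b d : le a b -> le b d -> le a d.
  move=> ab bd; have := idealizer_mul bd ab; rewrite /le /V; congr (idealizer P _).
  by apply/funext => u; rewrite /ratio mulrfctE mulrA divfK ?nz.
pose r' i j : int := if insub j is Some j' then r i j' else 0.
have r'E i (j : 'I_n) : r' i j = r i j by rewrite /r' valK.
(* A Laurent monomial [e] of nonnegative value should have nonnegative lifted weight: this is the
   inequality on [c] that expresses it. The system [s] consists of those coming from the ratios of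
   coordinates. *)
pose Q (a : nat -> int) (h : R) := exists e : 'I_M -> int,
  [/\ V (laurent e), forall j, a j = - \sum_i e i * r' i j & h = \sum_i (e i)%:~R * w i].
pose s := [seq ((fun j => r' il.1 j - r' il.2 j), w il.2 - w il.1) |
            il <- enum {: 'I_M * 'I_M} & `[< le il.1 il.2 >]].
have inS p : List.In p s -> exists i l, le i l /\ p = ((fun j => r' i j - r' l j), w l - w i).
  move=> /List.in_map_iff [[i l] [<- /list_inP]]; rewrite mem_filter => /andP[/asboolP ? _].
  by exists i, l.
have delta_sum (T : pzRingType) (i : 'I_M) (f : 'I_M -> T) : \sum_x (x == i)%:R * f x = f i.
  rewrite (bigD1 i) //= eqxx mul1r big1 ?addr0 // => x /negbTE ->.
  by rewrite mul0r.
have [||||c Hc] := @fourier_motzkin R n Q s.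
- move=> a b g h [e [Ve ea ->]] [e' [Ve' ea' ->]]; exists (fun i => e i + e' i); split.
  + by rewrite laurentD; apply: idealizer_mul.
  + move=> j; rewrite ea ea' -opprD -big_split; congr (- _).
    by apply: eq_bigr => i _; rewrite mulrDl.
  + by rewrite -big_split; apply: eq_bigr => i _; rewrite rmorphD mulrDl.
(* Consistency: if [e] has degree zero and negative weight, then its inverse monomial lies in [P],
   and multiplying by [laurent e] from [V] would put 1 into [P]. *)
- move=> a h a0 [e [Ve ea ->]]; rewrite leNgt; apply/negP => neg.
  apply: P1; rewrite -(laurentN e); apply: Ve; apply: PM0; apply: positive_part_laurent.
    move=> j; have := a0 j; rewrite ea => /eqP; rewrite oppr_eq0 => /eqP E.
    rewrite (eq_bigr (fun i => - (e i * r' i j))) ?sumrN ?E ?oppr0 // => i _.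
    by rewrite r'E mulNr.
  rewrite (eq_bigr (fun i => - ((e i)%:~R * w i))) ?sumrN ?oppr_gt0 // => i _.
  by rewrite rmorphN mulNr.
- move=> p j /inS [i [l [_ ->]]] nj /=.
  by rewrite /r' insubN ?subrr // -leqNgt.
- move=> p /inS [i [l [il ->]]] /=; exists (fun x => (x == l)%:R - (x == i)%:R); split.
  + suff -> : laurent (fun x => (x == l)%:R - (x == i)%:R) = ratio i l by [].
    apply/funext => u; rewrite /laurent /ratio.
    rewrite (eq_bigr (fun x => sval u x ^ ((x == l)%:R : int) * sval u x ^ (- (x == i)%:R : int))).
      rewrite big_split /=; congr (_ * _).
        rewrite (bigD1 l) //= eqxx expr1z big1 ?mulr1 // => x /negbTE ->.
        by rewrite expr0z.
      rewrite (bigD1 i) //= eqxx exprN1 big1 ?mulr1 // => x /negbTE ->.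
      by rewrite oppr0 expr0z.
    by move=> x _; rewrite expfzDr ?nz.
  + move=> j; rewrite (eq_bigr (fun x => (x == l)%:R * r' x j - (x == i)%:R * r' x j)).
      by rewrite sumrB !delta_sum opprB.
    by move=> x _; rewrite mulrBl.
  + rewrite (eq_bigr (fun x => (x == l)%:R * w x - (x == i)%:R * w x)).
      by rewrite sumrB !delta_sum.
    by move=> x _; rewrite rmorphB /= !rmorph_nat mulrBl.
exists (fun j => c j) => a aK [i0 ai0].
set b := fun i => w i + _.
have le_b i l : le i l -> b i <= b l.
  move=> il; have /Hc : List.In ((fun j => r' i j - r' l j), w l - w i) s.
    apply/List.in_map_iff; exists (i, l); split=> //; apply/list_inP.
    by rewrite mem_filter mem_enum andbT; apply/asboolP.
  rewrite /= (eq_bigr (fun j : 'I_n => (r i j)%:~R * c j - (r l j)%:~R * c j)); last first.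
    by move=> j _; rewrite !r'E rmorphB mulrBl.
  by rewrite sumrB /b; lra.
have [||l] := @total_minimum _ le (enum [pred i | a i != 0]) le_total.
- exact: le_trans.
- by apply/negP => /eqP E; have := mem_enum [pred i | a i != 0] i0; rewrite E in_nil inE ai0.
rewrite mem_enum inE => al lmin.
(* Either a second coordinate in the support has the least value, or all ratios to coordinate [l]
   lie in [P]; then the relation [a] divided by its term at [l] writes 1 as an element of [P]. *)
have [[i [il ai lei]]|none] := pselect (exists i, [/\ i != l, a i != 0 & le i l]).
  exists i, l; split=> // j aj; have lj : le l j by apply: lmin; rewrite mem_enum inE.
  by split; apply: le_b => //; apply: le_trans lj.
exfalso; apply: P1.
have -> : (1 : fn) = \sum_(i | i != l) (fun=> - (a i / a l)) * ratio l i.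
  apply/funext => u; rewrite fct_sumE.
  have [Ku _] := svalP u; have := aK _ Ku; rewrite (bigD1 l) //= => /eqP.
  rewrite addrC addr_eq0 => /eqP E.
  have nzl : a l * sval u l != 0 by rewrite mulf_neq0 ?nz.
  rewrite -[LHS]/(1 : F) -(divff nzl) -[X in X / _]opprK -E -sumrN mulr_suml.
  apply: eq_bigr => i _; rewrite mulrfctE /ratio mulNr mulNr; congr (- _).
  by rewrite invfM mulrACA.
apply: Vsum => i il; have [->|ai] := eqVneq (a i) 0.
  rewrite mul0r oppr0 -[fun=> 0]/(0 : fn) mul0r; exact: PM0 positive_part0.
apply: Pscale; first by exists (- (a i / a l)).
apply: (noninvertible_mem DN1 positive_part0 avP maxP (ratioV l i)).
  by apply: lmin; rewrite mem_enum inE.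
by move=> il'; apply: none; exists i.
Qed.

End WeightLifting.

(** * Tropicalization of the cone *)

Lemma pchar_CC : [pchar CC] =i pred0.
Proof. exact: (@pchar_num (complex RR)). Qed.

Lemma tropP (m : nat) (S : ('I_m.+1 -> CC) -> Prop) (w : 'rV[RR]_m.+1) :
  trop S w <-> forall (p : {mpoly CC[m.+1]}) (al : 'X_{1..m.+1}),
    (forall y, S y -> p.@[y] = 0) -> al \in msupp p ->
    ~ (forall be, be \in msupp p -> be != al -> wt (w ord0) al < wt (w ord0) be).
Proof.
pose lowest (p : {mpoly CC[m.+1]}) be := all (fun b => wt (w ord0) be <= wt (w ord0) b) (msupp p).
have coefE p be : (init_form w p)@_be = if lowest p be then p@_be else 0.
  exact: mcoeff_mpart.
split=> [trS p al pS alp uniq_al|H p p0 pS [c [al [c0 E]]]].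
  have nz : p@_al != 0 by rewrite -mcoeff_msupp.
  apply: (trS p) => //; first by apply: contraNneq nz => ->; rewrite mcoeff0.
  exists p@_al, al; split=> //; apply/mpolyP => be; rewrite coefE mcoeffZ mcoeffX.
  have [<-|ne] := eqVneq al be.
    rewrite mulr1 ifT //; apply/allP => b bp; have [->//|nb] := eqVneq b al.
    exact/ltW/uniq_al.
  rewrite mulr0; case: ifP => // /allP low; apply/eqP; apply: contraT.
  rewrite -mcoeff_msupp => /uniq_al; rewrite eq_sym => /(_ ne).
  by rewrite ltNge low.
have coef_c be : (init_form w p)@_be = c *+ (al == be).
  by rewrite E mcoeffZ mcoeffX mulr_natr.
have := coef_c al; rewrite coefE eqxx mulr1n; case: ifP => [/allP low pal|_ c0']; last first.
  by rewrite -c0' eqxx in c0.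
apply: (H p al pS); first by rewrite mcoeff_msupp pal.
move=> be bep ne; have := coef_c be; rewrite eq_sym (negbTE ne) coefE mulr0n.
case: ifP => [_ /eqP|/negbT nlow _]; first by rewrite -[_ == 0]negbK -mcoeff_msupp bep.
move/allPn: nlow => [b bp]; rewrite -ltNge; apply: le_lt_trans.
exact: low.
Qed.

Section TorusAction.
Variables (n m k : nat) (r : 'I_m.+1 -> 'I_n -> int).

Lemma kerAk_scale (t : CC) y : kerAk k r y -> kerAk k r (fun i => t * y i).
Proof.
move=> Ky be be_k; rewrite (eq_bigr (fun i => t * ((\prod_j r i j ^+ be j)%:~R * y i))).
  by rewrite -mulr_sumr Ky ?mulr0.
by move=> i _; rewrite mulrCA.
Qed.

Lemma kdual_cone_scale (t : CC) y : kdual_cone k r y -> kdual_cone k r (fun i => t * y i).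
Proof.
move=> /kdual_coneP [x x0 H]; apply/kdual_coneP; exists x => //.
have := kerAk_scale t H; congr (kerAk k r _).
by apply/funext => i; rewrite mulrA.
Qed.

(** The action is absorbed by dividing coordinate [j0] of the torus point by [t]. *)
Lemma kdual_cone_torus (t : CC) j0 y : t != 0 ->
  kdual_cone k r y -> kdual_cone k r (fun i => t ^ r i j0 * y i).
Proof.
move=> t0 /kdual_coneP [x x0 H]; apply/kdual_coneP.
exists (fun j => if j == j0 then x j / t else x j).
  by move=> j; case: ifP => // _; rewrite mulf_neq0 ?invr_eq0.
move: H; congr (kerAk k r _); apply/funext => i.
rewrite (bigD1 j0) //= [in RHS](bigD1 j0) //= eqxx expfzMl exprz_inv.
rewrite [\prod_(j | j != j0) (if _ then _ else _) ^ _](eq_bigr (fun j => x j ^ r i j)); last first.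
  by move=> j /negbTE ->.
rewrite -!mulrA [RHS]mulrCA; congr (_ * _); rewrite [RHS]mulrCA; congr (_ * _).
by rewrite mulrA -expfzDr // subrr expr0z mul1r.
Qed.

(** For [u = D *m Amx r] the weight of a monomial is the combination with coefficients [D] of its
    degrees for the rows of the matrix. *)
Lemma wt_rowspan (u : 'rV[RR]_m.+1) (al be : 'X_{1..m.+1}) :
  (u <= Amx r)%MS -> mgrade (fun=> 1) be = mgrade (fun=> 1) al ->
  (forall j, mgrade (fun i => r i j) be = mgrade (fun i => r i j) al) ->
  wt (u ord0) be = wt (u ord0) al.
Proof.
move=> /submxP [D ->] E0 Ej.
have E ga : wt ((D *m Amx r) ord0) ga = D ord0 ord0 * (mgrade (fun=> 1) ga)%:~R
    + \sum_j D ord0 (lift ord0 j) * (mgrade (fun i => r i j) ga)%:~R.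
  rewrite /wt (eq_bigr (fun i => \sum_x D ord0 x * ((ga i)%:R * Amx r x i))); last first.
    by move=> i _; rewrite mxE mulr_sumr; apply: eq_bigr => x _; rewrite mulrCA.
  rewrite exchange_big big_ord_recl; congr (_ + _); last apply: eq_bigr => j _;
    rewrite -mulr_sumr; congr (_ * _); rewrite rmorph_sum; apply: eq_bigr => i _;
    by rewrite mxE ?liftK ?unlift_none rmorphM.
by rewrite !E E0; congr (_ + _); apply: eq_bigr => j _; rewrite Ej.
Qed.

Lemma trop_kdual_cone_add (u v : 'rV[RR]_m.+1) :
  (u <= Amx r)%MS -> trop (kerAk k r) v -> trop (kdual_cone k r) (u + v).
Proof.
move=> uA /tropP trv; apply/tropP => p al pY alp uniq_al.
(* The gradings by the rows of [Amx r]; the first is the total degree. *)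
pose gs : seq ('I_m.+1 -> int) := (fun=> 1) :: [seq (fun i => r i j) | j <- enum 'I_n].
have Ygs g : List.In g gs -> forall t y, t != 0 -> kdual_cone k r y ->
    kdual_cone k r (fun i => t ^ g i * y i).
  move=> /= [<-|/List.in_map_iff [j [<- _]]] t y t0; last exact: kdual_cone_torus.
  by move=> /(kdual_cone_scale t); congr (kdual_cone k r _); apply/funext => i; rewrite expr1z.
have := mpart_all_vanish pchar_CC al Ygs pY.
set q := mpart _ _ => qY.
have qE be : be \in msupp q -> [/\ be \in msupp p, mgrade (fun=> 1) be = mgrade (fun=> 1) al
    & forall j, mgrade (fun i => r i j) be = mgrade (fun i => r i j) al].
  rewrite mcoeff_msupp mcoeff_mpart; case: ifP; last by rewrite eqxx.
  move=> /= /andP[/eqP g1 /allP gr]; rewrite -mcoeff_msupp => bep; split=> // j.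
  by apply/eqP/(gr (fun i => r i j))/map_f; rewrite mem_enum.
apply: (trv q al).
(* The kernel lies in the cone: take the torus point with all coordinates 1. *)
- move=> y Ky; apply: qY; apply/kdual_coneP; exists (fun=> 1); first by move=> j; apply: oner_neq0.
  move: Ky; congr (kerAk k r _); apply/funext => i.
  by rewrite big1 ?mulr1 // => j _; rewrite exp1rz.
- by rewrite mcoeff_msupp mcoeff_mpart ifT -?mcoeff_msupp //=; rewrite eqxx; apply/allP.
- move=> be /qE [bep g1 gr] ne; have := uniq_al be bep ne.
  have wtuv ga : wt ((u + v) ord0) ga = wt (u ord0) ga + wt (v ord0) ga.
    by rewrite /wt -big_split; apply: eq_bigr => i _; rewrite mxE mulrDr.
  by rewrite !wtuv (wt_rowspan uA g1 gr) ltrD2l.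
Qed.

Lemma trop_kerAk_of_min_twice (v : 'rV[RR]_m.+1) :
  (forall a : 'I_m.+1 -> CC, (forall y, kerAk k r y -> \sum_i a i * y i = 0) ->
     (exists i, a i != 0) -> min_twice (v ord0) a) ->
  trop (kerAk k r) v.
Proof.
move=> H; have [d [A [freeA KA]]] := kerAk_row_space k r.
apply/tropP => p al pK; apply: (linear_tropical_basis pchar_CC freeA).
  move=> a aA; apply: H => y /KA [s ->].
  rewrite (eq_bigr (fun i => \sum_x s ord0 x * (a i * A x i))); last first.
    by move=> i _; rewrite mxE mulr_sumr; apply: eq_bigr => x _; rewrite mulrCA.
  by rewrite exchange_big big1 // => x _; rewrite -mulr_sumr aA mulr0.
by move=> s; apply: pK; apply/KA; exists s.
Qed.

Lemma trop_kdual_cone_split (w : 'rV[RR]_m.+1) :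
  trop (kdual_cone k r) w -> exists u v : 'rV[RR]_m.+1,
    (u <= Amx r)%MS /\ trop (kerAk k r) v /\ w = u + v.
Proof.
move=> /tropP trw.
have [|c Hc] := @weight_lifting CC RR n m.+1 (kerAk k r) r (w ord0).
  (* All monomials of [p] have the degrees of [al], so moving a point by the torus multiplies the
     value of [p] by one nonzero factor [X]. *)
  move=> p al pK alp grade_p; apply: (trw p al _ alp) => y /kdual_coneP [x x0 Ky].
  have := pK _ Ky; rewrite !mevalE.
  pose X := \prod_j x j ^ mgrade (fun i => r i j) al.
  have X0 : X != 0 by apply/prodf_neq0 => j _; rewrite expfz_neq0.
  rewrite (eq_big_seq (fun be => p@_be * (\prod_i y i ^+ be i) * X)); last first.
    move=> be bep; rewrite -mulrA; congr (_ * _).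
    rewrite (eq_bigr (fun i => y i ^+ be i * (\prod_j x j ^ r i j) ^+ be i)); last first.
      by move=> i _; rewrite exprMn.
    rewrite big_split; congr (_ * _).
    rewrite (eq_bigr (fun i => \prod_j x j ^ ((be i)%:Z * r i j))); last first.
      move=> i _; rewrite -prodrXl; apply: eq_bigr => j _.
      by rewrite mulrC -exprz_exp.
    rewrite exchange_big; apply: eq_bigr => j _; rewrite -(grade_p be bep j).
    apply/esym/(big_morph (fun z => x j ^ z)) => [a b|]; last exact: expr0z.
    by rewrite expfzDr.
  by rewrite -mulr_suml => /eqP; rewrite mulf_eq0 (negbTE X0) orbF => /eqP.
(* The sign undoes the lifting, since [w] is [v] minus the shift by [c]; the lifting uses only the
   rows from [r], so the row of ones has coefficient 0. *)
pose D : 'rV[RR]_n.+1 := \row_a (if unlift ord0 a is Some j then - c j else 0).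
pose v : 'rV[RR]_m.+1 := \row_i (w ord0 i + \sum_j (r i j)%:~R * c j).
exists (D *m Amx r), v; split; first exact: submxMl.
split.
  apply: trop_kerAk_of_min_twice => a aK a0; have := Hc a aK a0.
  by congr (min_twice _ a); apply/funext => i; rewrite mxE.
apply/rowP => i; rewrite !mxE big_ord_recl !mxE unlift_none mul0r add0r addrC -addrA.
rewrite -big_split big1 ?addr0 // => j _ /=.
by rewrite !mxE liftK mulNr mulrC subrr.
Qed.

End TorusAction.

Theorem theorem5p2 (n m k : nat) (r : 'I_m.+1 -> 'I_n -> int) :
  injective r -> lattice_generates r -> (1 <= k)%N ->
  forall w : 'rV[RR]_m.+1,
    trop (kdual_cone k r) w <->
    exists u v : 'rV[RR]_m.+1,
      (u <= Amx r)%MS /\ trop (kerAk k r) v /\ w = u + v.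
Proof.
move=> _ _ _ w; split; first exact: trop_kdual_cone_split.
by move=> [u [v [uA [trv ->]]]]; apply: trop_kdual_cone_add.
Qed.
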